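(* Assume $x(0)=x'(0)=0$. Let $L_1(t,s)=\omega\sin(\omega(t-s))+\cos(\omega(t-s))$ and $L_2(t,s)=\omega^2\cos(\omega(t-s))-\omega\sin(\omega(t-s))$. The following are equivalent: (A) $y_1(t)\to0$ as $t\to\infty$, $\lim_{t\to\infty}\int_0^tE(t,s)L_1(t,s)y_1(s)\,ds=0$ and $\lim_{t\to\infty}\int_0^tE(t,s)L_2(t,s)y_1(s)\,ds=0$; (B) $x(t)\to0$ and $x'(t)\to0$ as $t\to\infty$.
   Context: Standing assumptions: $\omega>0$ is a constant; $p\in C^1([0,\infty))$ with $p(t)>0$ and $p'(t)<0$ for all $t\ge0$, $\int_0^\infty p(t)\,dt=\infty$ and $\int_0^\infty p(t)^2\,dt<\infty$; $f\in L^1_{\mathrm{loc}}([0,\infty))$. $x$ denotes the solution of $x''(t)+p(t)x'(t)+\omega^2x(t)=f(t)$, $t\ge0$. Notation: $E(t,s)=\exp(-\frac12\int_s^tp(\tau)\,d\tau)$ for $0\le s\le t$; $y_1(t)=\int_0^te^{-\omega^2(t-s)}f(s)\,ds$. *)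

(* Defs.v *)
From HB Require Import structures.
From mathcomp Require Import all_boot all_order all_algebra.
From mathcomp Require Import all_classical all_reals all_analysis.
Set Implicit Arguments. Unset Strict Implicit. Unset Printing Implicit Defensive.
Import Order.TTheory GRing.Theory Num.Theory.
Import numFieldNormedType.Exports.
Local Open Scope classical_set_scope.
Local Open Scope ring_scope.

Section Defs.
Variable R : realType.
Notation mu := (@lebesgue_measure R).

Definition Ef (p : R -> R) (t s : R) : R :=
  expR (- (2^-1 * Rintegral mu `[s, t] p)).

Definition y1 (w : R) (f : R -> R) (t : R) : R :=
  Rintegral mu `[0, t] (fun s => expR (- (w ^+ 2 * (t - s))) * f s).

Definition L1 (w t s : R) : R := w * sin (w * (t - s)) + cos (w * (t - s)).
Definition L2 (w t s : R) : R := w ^+ 2 * cos (w * (t - s)) - w * sin (w * (t - s)).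
End Defs.

(* Main.v *)
Require Import Defs.
From HB Require Import structures.
From mathcomp Require Import all_boot all_order all_algebra.
From mathcomp Require Import all_classical all_reals all_analysis.
From mathcomp Require Import measurable_realfun ring lra.
Import Order.TTheory GRing.Theory Num.Theory.
Import numFieldNormedType.Exports.
Local Open Scope classical_set_scope.
Local Open Scope ring_scope.

(** Put [y = y1], [u = x' + p x / 2 - y], and let [I1], [I2] be the two integrals
    of (A).  With [P] the primitive of [p], [(I1, I2)] solves the damped rotation
    [I1' = - p I1 / 2 + I2 + y], [I2' = - p I2 / 2 - w^2 I1 + w^2 y], while
    [D1 = x - I1] and [D2 = u - I2] satisfy the same system with forcing
    [(0, (p' / 2 + p^2 / 4) x - p y / 2)].  For the energy
    [V = w^2 D1^2 + D2^2] this gives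
    [V' <= - p V / 2 + r (D2^2 + x^2) + p y^2 / 2] with [r] integrable, so by a
    Gronwall argument ([P] tends to infinity) [V -> 0] as soon as [y -> 0] and
    either [x] or [I1] is bounded near infinity.  Hence (A) and (B) are
    equivalent once [y -> 0] is known; under (B) this comes from
    [v' = - w^2 v + (w^2 x' - p x' - w^2 x)] for [v = x' - y].
    Although [f], hence [y' = f - w^2 y], is merely locally integrable, [x' - y]
    is differentiable at every [t > 0], so everything is done with ordinary
    derivatives. *)

(** * Derivatives *)

Section calculus.
Context {R : realType}.
Implicit Types (f g : R -> R) (t u v : R).

Lemma is_derive1_funD f g t u v : is_derive t 1 f u -> is_derive t 1 g v ->
  is_derive t 1 (fun s => f s + g s) (u + v).
Proof. by move=> hf hg; exact: is_deriveD. Qed.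

Lemma is_derive1_funB f g t u v : is_derive t 1 f u -> is_derive t 1 g v ->
  is_derive t 1 (fun s => f s - g s) (u - v).
Proof. by move=> hf hg; exact: is_deriveB. Qed.

Lemma is_derive1_funM f g t u v : is_derive t 1 f u -> is_derive t 1 g v ->
  is_derive t 1 (fun s => f s * g s) (f t * v + g t * u).
Proof. by move=> hf hg; exact: is_deriveM. Qed.

Lemma is_derive1_funMc f (c : R) t u : is_derive t 1 f u ->
  is_derive t 1 (fun s => c * f s) (c * u).
Proof. by move=> hf; exact: is_deriveZ. Qed.

Lemma is_derive1_expR f t u : is_derive t 1 f u ->
  is_derive t 1 (fun s => expR (f s)) (expR (f t) * u).
Proof. by move=> hf; apply: is_derive1_comp. Qed.

Lemma is_derive1_continuous f t u : is_derive t 1 f u -> {for t, continuous f}.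
Proof. by move=> [df _]; apply/differentiable_continuous/derivable1_diffP. Qed.

Lemma nincreasing_of_derive (f df : R -> R) (a : R) :
  (forall t, a <= t -> is_derive t 1 f (df t)) ->
  (forall t, a < t -> df t <= 0) -> forall s t, a <= s -> s <= t -> f t <= f s.
Proof.
move=> fd f0 s t; apply: ler0_derive1_nincry.
- by move=> x; rewrite in_itv/= andbT => /ltW/fd[].
- move=> x; rewrite in_itv/= andbT => ax.
  by have /@derive_val := fd _ (ltW ax); rewrite derive1E => ->; exact: f0.
- apply: continuous_in_subspaceT => x; rewrite inE/= in_itv/= andbT => /fd.
  exact: is_derive1_continuous.
Qed.

Lemma ndecreasing_of_derive (f df : R -> R) (a : R) :
  (forall t, a <= t -> is_derive t 1 f (df t)) ->
  (forall t, a < t -> 0 <= df t) -> forall s t, a <= s -> s <= t -> f s <= f t.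
Proof.
move=> fd f0 s t; apply: ger0_derive1_ndecry.
- by move=> x; rewrite in_itv/= andbT => /ltW/fd[].
- move=> x; rewrite in_itv/= andbT => ax.
  by have /@derive_val := fd _ (ltW ax); rewrite derive1E => ->; exact: f0.
- apply: continuous_in_subspaceT => x; rewrite inE/= in_itv/= andbT => /fd.
  exact: is_derive1_continuous.
Qed.

(** The bound at [s = t] forces [f t = 0], and the difference quotient is then dominated by [|e s|],
    which tends to 0. *)
Lemma is_derive1_remainder f (e : R -> R) t :
  (\forall s \near t, `|f s| <= `|s - t| * `|e s|) -> e s @[s --> t] --> 0 ->
  is_derive t 1 f 0.
Proof.
move=> fe e0.
have ft : f t = 0.
  have := nbhs_singleton fe; rewrite subrr normr0 mul0r => ?.
  by apply/eqP; rewrite -normr_le0.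
have hc : h^-1 *: (f (h *: 1 + t) - f t) @[h --> 0^'] --> 0.
  apply/cvgr0Pnorm_le => eps eps0.
  have : \forall s \near t, `|f s| <= `|s - t| * eps.
    move/cvgr0Pnorm_le : e0 => /(_ _ eps0) e0; near=> s.
    apply: le_trans (_ : `|s - t| * `|e s| <= _); first by near: s.
    by rewrite ler_wpM2l//; near: s.
  move=> /nbhs0P H.
  have H' : \forall h \near (0:R), `|f (h + t)| <= `|h| * eps.
    by apply: filterS H => h; rewrite addrC addrK.
  near=> h.
  have h0 : h != 0 by near: h; exact: nbhs_dnbhs_neq.
  rewrite ft subr0 /GRing.scale/= mulr1 normrM normfV ler_pdivrMl ?normr_gt0//.
  by near: h; apply: cvg_within.
apply: DeriveDef; last exact/cvg_lim.
by apply/cvg_ex; exists 0.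
Unshelve. all: by end_near. Qed.

End calculus.

(** * Primitives of locally integrable functions *)

Section primitives.
Context {R : realType}.
Notation mu := (@lebesgue_measure R).
Implicit Types (f g : R -> R) (t T : R).

Definition locally_integrable0 f :=
  forall T, 0 <= T -> mu.-integrable `[0, T] (EFin \o f).

Definition primitive f t := Rintegral mu `[0, t] f.

Lemma integrable_subitv f (a b : R) : locally_integrable0 f -> 0 <= a -> 0 <= b ->
  mu.-integrable `[a, b] (EFin \o f).
Proof.
move=> lf a0 b0; apply: integrableS (lf b b0) => //.
by apply: subset_itvr; rewrite bnd_simp.
Qed.

Lemma primitive_increment f (a b : R) : locally_integrable0 f -> 0 <= a -> a <= b ->
  primitive f b - primitive f a = Rintegral mu `[a, b] f.
Proof.
move=> lf a0 ab; have b0 := le_trans a0 ab.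
rewrite /primitive Rintegral_itvB ?bnd_simp//; last exact: lf.
rewrite Rintegral_itv_obnd_cbnd//.
apply: integrableS (integrable_subitv _ _ _ lf a0 b0) => //.
exact: subset_itv_oc_cc.
Qed.

Lemma primitive_within f T : locally_integrable0 f -> 0 <= T ->
  {within `[0, T], continuous (primitive f)}.
Proof. by move=> lf T0; apply: parameterized_integral_continuous => //; exact: lf. Qed.

Lemma primitive_continuous f t : locally_integrable0 f -> 0 < t ->
  {for t, continuous (primitive f)}.
Proof.
move=> lf t0; have T0 : 0 < t + 1 by rewrite ltr_wpDr.
apply: (within_continuous_continuous T0 (primitive_within _ _ lf (ltW T0))).
by rewrite in_itv/= t0 ltrDl ltr01.
Qed.

Lemma is_derive_primitive f t : locally_integrable0 f -> 0 < t ->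
  {for t, continuous f} -> is_derive t 1 (primitive f) (f t).
Proof.
move=> lf t0 cf.
have t1 : t < t + 1 by rewrite ltrDl.
have [df f'] := continuous_FTC1_closed t1 (lf _ (ltW (lt_trans t0 t1))) t0 cf.
by apply: DeriveDef; [exact: df|rewrite -derive1E; exact: f'].
Qed.

Lemma le_primitive f (s t : R) : locally_integrable0 f ->
  (forall r, 0 <= r -> 0 <= f r) -> 0 <= s -> s <= t -> primitive f s <= primitive f t.
Proof.
move=> lf f0 s0 st; rewrite -subr_ge0 primitive_increment//.
by apply: Rintegral_ge0 => r /=; rewrite in_itv/= => /andP[sr _]; apply/f0/le_trans/sr.
Qed.

Lemma continuous_locally_integrable0 f :
  (forall T, 0 <= T -> {within `[0, T], continuous f}) -> locally_integrable0 f.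
Proof.
by move=> cf T T0; apply: continuous_compact_integrable; [exact: segment_compact|exact: cf].
Qed.

Lemma locally_integrable0_norm f : locally_integrable0 f ->
  locally_integrable0 (fun s => `|f s|).
Proof.
by move=> lf T T0; have := integrable_abse (lf T T0); apply: eq_integrable => // x _.
Qed.

Lemma locally_integrable0_mull f g :
  (forall T, 0 <= T -> {within `[0, T], continuous g}) -> locally_integrable0 f ->
  locally_integrable0 (fun s => g s * f s).
Proof.
move=> cg lf T T0; have mT : measurable (`[0, T] : set R) by [].
have := @integrableMr _ _ _ mu _ mT g (EFin \o f) _ _ (lf T T0).
apply.
- by apply: subspace_continuous_measurable_fun => //; exact: cg.
- have /compact_bounded[M [_ mrt]] := continuous_compact (cg T T0) (@segment_compact _ _ _).
  by exists M; split; rewrite ?num_real // => ? ? ? ?; exact: mrt.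
Qed.

(* The bound is [o(b - a)]: it makes the integration by parts below work at
   every point although [f] itself need not be continuous anywhere. *)
Lemma primitive_mull_increment f g (L a b c : R) : locally_integrable0 f ->
  (forall T, 0 <= T -> {within `[0, T], continuous g}) ->
  0 <= a -> a <= b ->
  (forall s, a <= s <= b -> `|g c - g s| <= L * (b - a)) ->
  `|g c * (primitive f b - primitive f a) -
    (primitive (fun s => g s * f s) b - primitive (fun s => g s * f s) a)| <=
  L * (b - a) * (primitive (fun s => `|f s|) b - primitive (fun s => `|f s|) a).
Proof.
move=> lf cg a0 ab gL; have b0 := le_trans a0 ab.
have lgf := locally_integrable0_mull _ _ cg lf.
have lf' := locally_integrable0_norm _ lf.
rewrite !primitive_increment//.
have mab : measurable (`[a, b] : set R) by [].
have if1 := integrable_subitv _ _ _ lf a0 b0.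
have if2 := integrable_subitv _ _ _ lgf a0 b0.
have if3 := integrable_subitv _ _ _ lf' a0 b0.
have if4 : mu.-integrable `[a, b] (EFin \o (fun s => g c * f s)).
  by have := @integrableZl _ _ _ mu _ mab (g c) _ if1; apply: eq_integrable.
have if5 : mu.-integrable `[a, b] (EFin \o (fun s => g c * f s - g s * f s)).
  by have := @integrableB _ _ _ mu _ mab _ _ if4 if2; apply: eq_integrable.
rewrite -RintegralZl// -RintegralB//.
apply: le_trans (le_normr_Rintegral _ if5) _ => //.
rewrite -RintegralZl//; apply: le_Rintegral => //.
- by have := integrable_abse if5; apply: eq_integrable.
- by have := @integrableZl _ _ _ mu _ mab (L * (b - a)) _ if3; apply: eq_integrable.
- move=> s /=; rewrite in_itv/= => sab.
  by rewrite -mulrBl normrM ler_wpM2r//; exact: gL.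
Qed.

Lemma is_derive_primitive_by_parts f g t (dg L : R) : locally_integrable0 f ->
  (forall T, 0 <= T -> {within `[0, T], continuous g}) -> 0 < t ->
  (forall a b, 0 <= a <= t + 1 -> 0 <= b <= t + 1 -> `|g a - g b| <= L * `|a - b|) ->
  is_derive t 1 g dg ->
  is_derive t 1 (fun s => g s * primitive f s - primitive (fun r => g r * f r) s)
    (dg * primitive f t).
Proof.
move=> lf cg t0 gL g'; set F := primitive f; set G := primitive _.
(* The points [t] and [t + 1] are at distance 1, so the Lipschitz bound there puts [L] above an
   absolute value. *)
have L0 : 0 <= L.
  have := gL t (t + 1); rewrite opprD addNKr normrN normr1 mulr1.
  move=> h; apply: le_trans (h _ _); rewrite // ?lerDl ?ler01 ?lexx ?andbT ltW//.
  by rewrite ltr_wpDr.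
pose Phi := primitive (fun s => `|f s|).
have lf' := locally_integrable0_norm _ lf.
have mPhi a b : 0 <= a -> a <= b -> Phi a <= Phi b by move=> *; exact: le_primitive.
pose Rm s := g s * (F s - F t) - (G s - G t).
suff Rm0 : is_derive t 1 Rm 0.
  have -> : (fun s => g s * F s - G s) =
      (fun s => Rm s + (F t * g s + (- G t))).
    by apply/funext => s; rewrite /Rm; ring.
  apply: is_derive_eq (is_derive1_funD _ _ _ _ _ Rm0
    (is_derive1_funD _ _ _ _ _ (is_derive1_funMc _ (F t) _ _ g')
      (is_derive_cst (- G t) t 1))) _.
  by rewrite add0r addr0 mulrC.
apply: (@is_derive1_remainder _ _ (fun s => L * (Phi s - Phi t))).
  near=> s.
  have s0 : 0 <= s by apply/ltW; near: s; exact: lt_nbhsr.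
  have s1 : s <= t + 1 by apply/ltW; near: s; apply: lt_nbhsl; rewrite ltrDl.
  rewrite normrM (ger0_norm L0) mulrCA mulrA.
  have [ts|st] := leP t s.
    rewrite (ger0_norm (_ : 0 <= s - t)) ?subr_ge0//.
    rewrite (ger0_norm (_ : 0 <= Phi s - Phi t)) ?subr_ge0 ?mPhi// ?(ltW t0)//.
    apply: primitive_mull_increment => //; first exact: ltW.
    move=> r /andP[tr rs]; apply: le_trans (gL _ _ _ _) _; rewrite ?s0 ?s1//.
      by rewrite (le_trans (ltW t0) tr) (le_trans rs s1).
    by rewrite ler_wpM2l// ger0_norm ?subr_ge0// lerB.
  (* For [s < t] the increment is read from [s] to [t]; [g] stays frozen at [s], now the left
     endpoint. *)
  have -> : Rm s = - (g s * (F t - F s) - (G t - G s)) by rewrite /Rm; ring.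
  rewrite normrN (distrC s) (distrC (Phi s)) (ger0_norm (_ : 0 <= t - s)) ?subr_ge0 ?(ltW st)//.
  rewrite (ger0_norm (_ : 0 <= Phi t - Phi s)) ?subr_ge0 ?mPhi// ?(ltW st)//.
  apply: primitive_mull_increment => //; first exact: ltW.
  move=> r /andP[sr rt]; apply: le_trans (gL _ _ _ _) _; rewrite ?s0 ?s1//.
    by rewrite (le_trans s0 sr)/= (le_trans rt)// lerDl.
  by rewrite ler_wpM2l// distrC ger0_norm ?subr_ge0// lerD2r.
have := primitive_continuous _ _ lf' t0; rewrite -/Phi => cPhi.
have : L * (Phi s - Phi t) @[s --> t] --> L * (Phi t - Phi t).
  by apply: cvgM; [exact: cvg_cst|apply: cvgB; [exact: cPhi|exact: cvg_cst]].
by rewrite subrr mulr0.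
Unshelve. all: by end_near. Qed.

Lemma EFin_primitive f t : locally_integrable0 f -> 0 <= t ->
  (primitive f t)%:E = (\int[mu]_(s in `[0%R, t]) (f s)%:E)%E.
Proof.
move=> lf t0; rewrite /primitive /Rintegral fineK//.
by apply: integrable_fin_num => //; exact: lf.
Qed.

(** Monotone convergence along the sets [[0, n]], which exhaust the half-line. *)
Lemma cvg_primitive_nat f : locally_integrable0 f -> (forall r, 0 <= r -> 0 <= f r) ->
  (primitive f n%:R)%:E @[n --> \oo] --> (\int[mu]_(s in `[0%R, +oo[%classic) (f s)%:E)%E.
Proof.
move=> lf f0; under eq_fun do rewrite EFin_primitive//.
have -> : `[0%R, +oo[%classic = \bigcup_n `[0%R, n%:R : R]%classic.
  apply/seteqP; split => [s|s [n _]]/=; rewrite !in_itv/= ?andbT; last by case/andP.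
  by move=> s0; exists (Num.truncn s).+1 => //=; rewrite in_itv/= s0 ltW// truncnS_gt.
apply: ge0_nondecreasing_set_cvg_integral.
- by move=> m n mn; apply/subsetPset/subset_itvl; rewrite bnd_simp ler_nat.
- by [].
- by move=> n; exact: measurable_int (lf n%:R (ler0n _ _)).
- by move=> n s /=; rewrite in_itv/= => /andP[s0 _]; rewrite lee_fin f0.
Qed.

Lemma primitive_infty f : locally_integrable0 f -> (forall r, 0 <= r -> 0 <= f r) ->
  (\int[mu]_(s in `[0%R, +oo[%classic) (f s)%:E = +oo)%E ->
  primitive f t @[t --> +oo] --> +oo.
Proof.
move=> lf f0 foo; have := cvg_primitive_nat _ lf f0; rewrite foo => /cvgeyPge fy.
apply/cvgryPge => A; have [n _ /(_ n (leqnn n))/=] := fy A; rewrite lee_fin => An.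
(* Monotonicity of the primitive carries divergence from the integers to the reals. *)
near=> t; apply: le_trans An _; apply: le_primitive => //.
Unshelve. all: by end_near. Qed.

Lemma primitive_bounded f : locally_integrable0 f -> (forall r, 0 <= r -> 0 <= f r) ->
  (\int[mu]_(s in `[0%R, +oo[%classic) (f s)%:E < +oo)%E ->
  exists B, forall t, 0 <= t -> 0 <= primitive f t <= B.
Proof.
move=> lf f0 foo; have := cvg_primitive_nat _ lf f0.
set I := (X in _ --> X) => fI.
have If : I \is a fin_num.
  rewrite ge0_fin_numE// integral_ge0// => s /=.
  by rewrite in_itv/= andbT => s0; rewrite lee_fin f0.
exists (fine I) => t t0; apply/andP; split.
  by apply: Rintegral_ge0 => s /=; rewrite in_itv/= => /andP[/f0].
rewrite -lee_fin (fineK If); apply: cvge_ge fI.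
near=> n; rewrite lee_fin; apply: le_primitive => //.
by near: n; exact: nbhs_infty_ger.
Unshelve. all: by end_near. Qed.

End primitives.

(** * A differential inequality *)

Section decay.
Context {R : realType}.

(** Two integrating factors are used. The weight [exp(- C Q)], bounded below since [Q <= B], removes
    [C r V]. Past a time [T] where [h <= M] and [k <= e], the function [Z = U - e - M (Q - Q T)]
    then satisfies [Z' <= - a Z], so [exp(A) Z] is nonincreasing and [Z] is eventually at most
    [e]. *)
Lemma cvg0_of_differential_inequality (a A r Q k h V dV : R -> R) (C M B : R) :
  (forall t : R, 0 < t -> is_derive t 1 A (a t)) ->
  (forall t : R, 0 < t -> is_derive t 1 Q (r t)) ->
  (forall t : R, 0 < t -> is_derive t 1 V (dV t)) ->
  (forall t : R, 0 < t -> 0 <= a t) -> (forall t : R, 0 < t -> 0 <= r t) ->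
  (forall t : R, 0 < t -> 0 <= V t) -> (forall t : R, 0 < t -> 0 <= Q t <= B) ->
  A t @[t --> +oo] --> +oo -> k t @[t --> +oo] --> 0 ->
  (\forall t \near +oo, h t <= M) -> 0 <= C -> 0 <= M ->
  (forall t : R, 0 < t -> dV t <= - (a t * V t) + r t * (C * V t + h t) + a t * k t) ->
  V t @[t --> +oo] --> 0.
Proof.
move=> dA dQ dV' a0 r0 V0 QB Aoo k0 hM C0 M0 ineq.
have mQ s t : 0 < s -> s <= t -> Q s <= Q t.
  move=> s0; apply: (@ndecreasing_of_derive _ Q r s) => //.
  - by move=> u su; apply: dQ; exact: lt_le_trans su.
  - by move=> u su; apply: r0; exact: lt_trans su.
pose U t := expR (- C * Q t) * V t.
have UE t : V t = expR (C * Q t) * U t.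
  by rewrite /U mulrA -expRD mulNr subrr expR0 mul1r.
have small e : 0 < e -> \forall t \near +oo, U t <= (2 + M) * e.
  move=> e0.
  (* [Q] is bounded and nondecreasing: [T0] is a time at which it is within [e] of its supremum. *)
  have [T0 [T00 QT0]] : exists T0, 0 < T0 /\ forall t, T0 <= t -> Q t - Q T0 <= e.
    pose E := [set Q t | t in [set t | 0 < t]].
    have supE : has_sup E.
      split; first by exists (Q 1), 1 => //=.
      by exists B => _ [t t0 <-]; have /andP[] := QB t t0.
    have [_ [T0 /= T00 <-] ET0] := sup_adherent e0 supE.
    exists T0; split => // t Tt.
    have : Q t <= sup E.
      by apply: sup_upper_bound => //; exists t => //=; exact: lt_le_trans Tt.
    lra.
  have : \forall T \near +oo, T0 <= T /\ (forall t, T <= t -> h t <= M /\ k t <= e).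
    have ke : \forall t \near +oo, k t <= e.
      move/cvgr0Pnorm_le : k0 => /(_ _ e0); apply: filterS => t.
      exact/le_trans/ler_norm.
    have [T1 [_ H]] := filterI hM ke.
    near=> T; split; first by near: T; apply: nbhs_pinfty_ge; rewrite num_real.
    move=> t Tt; apply: H; apply: lt_le_trans Tt; near: T.
    by apply: nbhs_pinfty_gt; rewrite num_real.
  move=> /filter_ex[T [T0T HT]].
  have T_gt0 : 0 < T by exact: lt_le_trans T0T.
  pose Z t := U t - e - M * (Q t - Q T).
  pose W t := expR (A t) * Z t.
  have WT t : T <= t -> W t <= W T.
    pose dW t := expR (A t) * (expR (- C * Q t) * dV t + V t * (expR (- C * Q t) * (- C * r t))
      - 0 - M * (r t - 0)) + Z t * (expR (A t) * a t).
    move=> Tt; apply: (@nincreasing_of_derive _ W dW T) => //.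
    - move=> u Tu; have u0 : 0 < u by exact: lt_le_trans Tu.
      have Qu := dQ _ u0; have Au := dA _ u0; have Vu := dV' _ u0.
      have eA := is_derive1_expR _ _ _ Au.
      have eQ := is_derive1_expR _ _ _ (is_derive1_funMc _ (- C) _ _ Qu).
      have Ud := is_derive1_funB _ _ _ _ _ (is_derive1_funM _ _ _ _ _ eQ Vu)
        (is_derive_cst e u 1).
      have Qd := is_derive1_funMc _ M _ _
        (is_derive1_funB _ _ _ _ _ Qu (is_derive_cst (Q T) u 1)).
      exact: is_derive1_funM _ _ _ _ _ eA (is_derive1_funB _ _ _ _ _ Ud Qd).
    - move=> u Tu; have u0 : 0 < u by exact: lt_trans Tu.
      have [hu ku] := HT _ (ltW Tu).
      pose E := expR (- C * Q u).
      have E0 : 0 < E by exact: expR_gt0.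
      have E1 : E <= 1.
        rewrite -expR0 ler_expR mulNr oppr_le0 mulr_ge0//.
        by have /andP[] := QB _ u0.
      (* Factoring out [exp(A)] leaves [Z' + a Z], whose sign is to be determined. *)
      have -> : dW u = expR (A u) * (E * (dV u - C * (r u * V u)) - M * r u
           + a u * (E * V u - e - M * (Q u - Q T))).
        by rewrite /dW /Z /U -/E; ring.
      rewrite mulr_ge0_le0 ?expR_ge0//.
      have i1 : E * (dV u - C * (r u * V u)) <= E * (- (a u * V u) + r u * M + a u * e).
        rewrite ler_wpM2l// ?(ltW E0)//.
        have := ineq _ u0; have := ler_wpM2l (r0 _ u0) hu; have := ler_wpM2l (a0 _ u0) ku.
        lra.
      have i2 : E * (r u * M) <= r u * M.
        by rewrite ler_piMl// mulr_ge0 ?r0.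
      have i3 : E * (a u * e) <= a u * e.
        by rewrite ler_piMl// mulr_ge0 ?a0// ltW.
      have i4 : 0 <= a u * (M * (Q u - Q T)).
        by rewrite mulr_ge0 ?a0// mulr_ge0// subr_ge0 mQ// ltW.
      lra.
  (* As [exp(A) >= 1 + A] is unbounded, it eventually absorbs the initial value [W T]. *)
  have : \forall t \near +oo, `|W T| / e <= expR (A t).
    move/cvgryPge : Aoo => /(_ (`|W T| / e)); apply: filterS => t /le_trans; apply.
    by apply: le_trans (expR_ge1Dx _); rewrite lerDr.
  move=> At; near=> t.
  have Tt : T <= t by near: t; apply: nbhs_pinfty_ge; rewrite num_real.
  have Zt : Z t <= e.
    have WTt : W t <= expR (A t) * e.
      apply: le_trans (WT _ Tt) _; apply: le_trans (ler_norm _) _.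
      by rewrite -ler_pdivrMr//; near: t.
    by rewrite -(ler_pM2l (expR_gt0 (A t))).
  have Qt : M * (Q t - Q T) <= M * e.
    rewrite ler_wpM2l//; have := QT0 _ (le_trans T0T Tt); have := mQ _ _ T00 T0T.
    lra.
  move: Zt; rewrite /Z; lra.
apply/cvgr0Pnorm_le => e e0.
(* [D] collects the loss in returning from [U] to [V], at most [exp(C B)], and the factor [2 + M] of
   [small]. *)
pose D := expR (C * B) * (2 + M).
have D0 : 0 < D by rewrite mulr_gt0 ?expR_gt0// ltr_wpDr.
near=> t.
have t0 : 0 < t by near: t; apply: nbhs_pinfty_gt; rewrite num_real.
rewrite ger0_norm ?V0// UE.
have /andP[_ QtB] := QB _ t0.
apply: (@le_trans _ _ (expR (C * B) * ((2 + M) * (e / D)))); last first.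
  by rewrite mulrA -/D mulrCA divff ?mulr1// gt_eqF.
apply: ler_pM; rewrite ?expR_ge0//.
- by rewrite mulr_ge0 ?expR_ge0 ?V0.
- by rewrite ler_expR ler_wpM2l.
- by near: t; apply: small; rewrite divr_gt0.
Unshelve. all: by end_near. Qed.

End decay.

(** * The damped rotation and the relaxation [y1] *)

Section damped_oscillator.
Context {R : realType}.
Notation mu := (@lebesgue_measure R).
Implicit Types (f g p y : R -> R).

Lemma within_continuousM f g (T : R) : {within `[0, T], continuous f} ->
  {within `[0, T], continuous g} -> {within `[0, T], continuous (fun s => f s * g s)}.
Proof. by move=> cf cg s; apply: cvgM; [exact: cf|exact: cg]. Qed.

Lemma within_continuous_expR f (T : R) : {within `[0, T], continuous f} ->
  {within `[0, T], continuous (fun s => expR (f s))}.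
Proof.
move=> cf s; apply: (@continuous_comp _ _ _ (f : subspace _ -> R) expR); first exact: cf.
exact: continuous_expR.
Qed.

(** The addition formulas and the splitting of [E(t,s)] into [exp(- P t / 2) exp(P s / 2)] separate
    [t] from [s], so only integrands free of [t] remain. *)
Definition damped_cos p y (w t : R) :=
  primitive (fun s => expR (2^-1 * primitive p s) * cos (w * s) * y s) t.
Definition damped_sin p y (w t : R) :=
  primitive (fun s => expR (2^-1 * primitive p s) * sin (w * s) * y s) t.

(** For locally integrable [p] and continuous [y], these two responses are the integrals over
    [[0, t]] of [E(t,s) cos(w (t - s)) y(s)] and [E(t,s) sin(w (t - s)) y(s)]. *)
Definition cos_response p y (w t : R) := expR (- (2^-1 * primitive p t)) *
  (cos (w * t) * damped_cos p y w t + sin (w * t) * damped_sin p y w t).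
Definition sin_response p y (w t : R) := expR (- (2^-1 * primitive p t)) *
  (sin (w * t) * damped_cos p y w t - cos (w * t) * damped_sin p y w t).

Section fixed_data.
Context (p y : R -> R) (w : R).
Context (lp : locally_integrable0 p)
  (cy : forall T, 0 <= T -> {within `[0, T], continuous y}).

Let ldamped (a : R -> R) : continuous a ->
  locally_integrable0 (fun s => expR (2^-1 * primitive p s) * a (w * s) * y s).
Proof.
move=> ca; apply: continuous_locally_integrable0 => T T0.
apply: within_continuousM; last exact: cy.
apply: within_continuousM.
  apply: within_continuous_expR; apply: within_continuousM.
    by apply: continuous_subspaceT => s; exact: cvg_cst.
  exact: primitive_within.
apply: continuous_subspaceT => s.
by apply: (continuous_comp (f := fun s => w * s)); [exact: mulrl_continuous|exact: ca].
Qed.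

Let lcos := ldamped cos (@continuous_cos R).
Let lsin := ldamped sin (@continuous_sin R).

Lemma damped_integralE (al be t : R) : 0 <= t ->
  Rintegral mu `[0, t] (fun s => Ef p t s *
    (al * cos (w * (t - s)) + be * sin (w * (t - s))) * y s) =
  al * cos_response p y w t + be * sin_response p y w t.
Proof.
move=> t0.
have m0t : measurable (`[0, t] : set R) by [].
(* [A] and [B] are the coefficients of [cos(w s)] and [sin(w s)] once the kernel is expanded. *)
pose A := expR (- (2^-1 * primitive p t)) * (al * cos (w * t) + be * sin (w * t)).
pose B := expR (- (2^-1 * primitive p t)) * (al * sin (w * t) - be * cos (w * t)).
have lc := lcos t t0; have ls := lsin t t0.
have lc' := @integrableZl _ _ _ mu _ m0t A _ lc.
have ls' := @integrableZl _ _ _ mu _ m0t B _ ls.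
transitivity (Rintegral mu `[0, t] (fun s =>
    A * (expR (2^-1 * primitive p s) * cos (w * s) * y s) +
    B * (expR (2^-1 * primitive p s) * sin (w * s) * y s))).
  apply: eq_Rintegral => s; rewrite inE/= in_itv/= => /andP[s0 st].
  rewrite /Ef -primitive_increment// mulrBr opprB addrC expRD.
  rewrite mulrBr cosB sinB /A /B; ring.
rewrite RintegralD// ?RintegralZl//.
rewrite /cos_response /sin_response /damped_cos /damped_sin /primitive /A /B.
ring.
Qed.

(** Differentiating the inner primitives produces [(cos^2 + sin^2) y = y] in the first response and
    cancelling cross terms in the second; the outer factors give the damping and the rotation. *)
Lemma is_derive_responses (t : R) : 0 < t -> {for t, continuous p} -> {for t, continuous y} ->
  is_derive t 1 (cos_response p y w)
    (- (2^-1 * p t) * cos_response p y w t - w * sin_response p y w t + y t) /\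
  is_derive t 1 (sin_response p y w)
    (- (2^-1 * p t) * sin_response p y w t + w * cos_response p y w t).
Proof.
move=> t0 cp cyt.
have dP := is_derive_primitive _ _ lp t0 cp.
have cP : {for t, continuous (primitive p)} by exact: is_derive1_continuous dP.
have ce : expR (2^-1 * primitive p s) @[s --> t] --> expR (2^-1 * primitive p t).
  apply: (continuous_comp (f := fun s => 2^-1 * primitive p s)); last exact: continuous_expR.
  by apply: cvgM; [exact: cvg_cst|exact: cP].
have dwt : is_derive t 1 (fun s : R => w * s) w.
  by apply: is_derive_eq (is_derive1_funMc id w t 1 _) _; rewrite ?mulr1.
have dcos : is_derive t 1 (fun s => cos (w * s)) (- sin (w * t) * w).
  exact: is_derive1_comp.
have dsin : is_derive t 1 (fun s => sin (w * s)) (cos (w * t) * w).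
  exact: is_derive1_comp.
have dc : is_derive t 1 (damped_cos p y w) (expR (2^-1 * primitive p t) * cos (w * t) * y t).
  apply: (is_derive_primitive _ _ lcos t0).
  apply: cvgM => //; apply: cvgM => //; exact: is_derive1_continuous dcos.
have ds : is_derive t 1 (damped_sin p y w) (expR (2^-1 * primitive p t) * sin (w * t) * y t).
  apply: (is_derive_primitive _ _ lsin t0).
  apply: cvgM => //; apply: cvgM => //; exact: is_derive1_continuous dsin.
have dE : is_derive t 1 (fun s => expR (- (2^-1 * primitive p s)))
    (expR (- (2^-1 * primitive p t)) * - (2^-1 * p t)).
  by apply: is_derive1_expR; apply: is_deriveN; exact: is_derive1_funMc.
have EE : expR (- (2^-1 * primitive p t)) * expR (2^-1 * primitive p t) = 1.
  by rewrite -expRD addNr expR0.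
have cs := cos2Dsin2 (w * t).
split.
- apply: is_derive_eq (is_derive1_funM _ _ _ _ _ dE (is_derive1_funD _ _ _ _ _
    (is_derive1_funM _ _ _ _ _ dcos dc) (is_derive1_funM _ _ _ _ _ dsin ds))) _.
  rewrite /cos_response /sin_response.
  set e := expR (- _) in EE *; set e' := expR _ in EE *.
  transitivity (e * e' * (cos (w * t) ^+ 2 + sin (w * t) ^+ 2) * y t +
    (- (2^-1 * p t) * (e * (cos (w * t) * damped_cos p y w t + sin (w * t) * damped_sin p y w t)) -
     w * (e * (sin (w * t) * damped_cos p y w t - cos (w * t) * damped_sin p y w t)))).
    ring.
  by rewrite EE cs !mul1r addrC.
- apply: is_derive_eq (is_derive1_funM _ _ _ _ _ dE (is_derive1_funB _ _ _ _ _
    (is_derive1_funM _ _ _ _ _ dsin dc) (is_derive1_funM _ _ _ _ _ dcos ds))) _.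
  rewrite /cos_response /sin_response; ring.
Qed.

End fixed_data.
End damped_oscillator.

(** * The relaxation equation [y' = f - w^2 y] for integrable [f] *)

Section relaxation.
Context {R : realType}.
Notation mu := (@lebesgue_measure R).
Context (w : R) (f : R -> R) (lf : locally_integrable0 f).

Let within_expR (T : R) : {within `[0, T], continuous (fun s => expR (w ^+ 2 * s))}.
Proof.
apply: continuous_subspaceT => s.
by apply: (continuous_comp (f := fun s => w ^+ 2 * s));
  [exact: mulrl_continuous|exact: continuous_expR].
Qed.

(** Pulling [exp(- w^2 t)] out of [y1] leaves a primitive, with an integrand free of [t]. *)
Definition relax (t : R) :=
  expR (- (w ^+ 2 * t)) * primitive (fun s => expR (w ^+ 2 * s) * f s) t.

Let lef : locally_integrable0 (fun s => expR (w ^+ 2 * s) * f s).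
Proof. by apply: locally_integrable0_mull => // T _; exact: within_expR. Qed.

Lemma y1E (t : R) : 0 <= t -> y1 w f t = relax t.
Proof.
move=> t0; have m0t : measurable (`[0, t] : set R) by [].
rewrite /y1 /relax /primitive -RintegralZl//; last exact: lef.
apply: eq_Rintegral => s _.
by rewrite mulrBr opprB addrC expRD mulrA.
Qed.

Lemma relax_within (T : R) : 0 <= T -> {within `[0, T], continuous relax}.
Proof.
move=> T0; apply: within_continuousM; last exact: primitive_within.
apply: continuous_subspaceT => s.
apply: (continuous_comp (f := fun s => - (w ^+ 2 * s))); last exact: continuous_expR.
by apply: cvgN; exact: mulrl_continuous.
Qed.

Lemma relax_continuous (t : R) : 0 < t -> {for t, continuous relax}.
Proof.
move=> t0; have T0 : 0 < t + 1 by rewrite ltr_wpDr.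
apply: (within_continuous_continuous T0 (relax_within _ (ltW T0))).
by rewrite in_itv/= t0 ltrDl ltr01.
Qed.

(** The difference equals [exp(- w^2 s)] times the by-parts expression for [g = exp(w^2 s)], so the
    rough terms in [f] cancel before differentiation. *)
Lemma is_derive_primitive_sub_relax (t : R) : 0 < t ->
  is_derive t 1 (fun s => primitive f s - relax s) (w ^+ 2 * relax t).
Proof.
move=> t0; pose g (s : R) := expR (w ^+ 2 * s).
have dlin (c s : R) : is_derive s 1 (fun r : R => c * r) c.
  by apply: is_derive_eq (is_derive1_funMc id c s 1 _) _; rewrite ?mulr1.
have dg (s : R) : is_derive s 1 g (g s * w ^+ 2) by apply: is_derive1_expR.
have cg (s : R) : {for s, continuous g} by exact: is_derive1_continuous (dg s).
(* [g' = w^2 g] is nondecreasing, so its value at [t + 1] is a Lipschitz constant on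
   [[0, t + 1]]. *)
pose L := g (t + 1) * w ^+ 2.
have lip (a b : R) : 0 <= a -> a <= b -> b <= t + 1 -> `|g a - g b| <= L * `|a - b|.
  move=> a0 ab bt.
  have [c + gab] : exists2 c, c \in `[a, b] & g b - g a = (g c * w ^+ 2) * (b - a).
    apply: (@MVT_segment _ g (fun s => g s * w ^+ 2)) => //.
    by apply: continuous_subspaceT => s; exact: cg.
  rewrite in_itv/= => /andP[_ cb].
  rewrite distrC gab (distrC a) normrM ler_wpM2r// ger0_norm; last first.
    by rewrite mulr_ge0 ?expR_ge0 ?sqr_ge0.
  by rewrite ler_wpM2r ?sqr_ge0// ler_expR ler_wpM2l ?sqr_ge0// (le_trans cb).
have lip2 : forall a b : R, 0 <= a <= t + 1 -> 0 <= b <= t + 1 -> `|g a - g b| <= L * `|a - b|.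
  move=> a b /andP[a0 at1] /andP[b0 bt1]; have [ab|/ltW ba] := leP a b; first exact: lip.
  by rewrite distrC (distrC a); exact: lip.
have dJ := is_derive_primitive_by_parts _ _ _ _ _ lf (fun T _ => within_expR T) t0 lip2 (dg t).
have de : is_derive t 1 (fun s => expR (- (w ^+ 2 * s)))
    (expR (- (w ^+ 2 * t)) * - w ^+ 2).
  by apply: is_derive1_expR; apply: is_deriveN; exact: dlin.
have eg (s : R) : expR (- (w ^+ 2 * s)) * g s = 1 by rewrite -expRD addNr expR0.
have -> : (fun s => primitive f s - relax s) = (fun s => expR (- (w ^+ 2 * s)) *
    (g s * primitive f s - primitive (fun r => g r * f r) s)).
  by apply/funext => s; rewrite mulrBr mulrA eg mul1r.
apply: is_derive_eq (is_derive1_funM _ _ _ _ _ de dJ) _.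
rewrite /relax -/(g _).
ring.
Qed.

End relaxation.

(** * The energy argument *)

Section limits.
Context {R : realType}.
Implicit Types (f g : R -> R).

Lemma cvg0_of_sqr_le f g (c : R) : 0 < c -> (\forall t \near +oo, c * f t ^+ 2 <= g t) ->
  g t @[t --> +oo] --> 0 -> f t @[t --> +oo] --> 0.
Proof.
move=> c0 fg /cvgr0Pnorm_le g0; apply/cvgr0Pnorm_le => e e0.
near=> t.
rewrite -(ler_pXn2r (_ : 0 < 2)%N) ?nnegrE ?(ltW e0)// real_normK ?num_real//.
rewrite -(ler_pM2l c0); apply: (@le_trans _ _ (g t)); first by near: t.
apply: le_trans (ler_norm _) _; near: t; apply: g0.
by rewrite mulr_gt0// exprn_gt0.
Unshelve. all: by end_near. Qed.

Lemma cvg0_sqr f : f t @[t --> +oo] --> 0 -> f t ^+ 2 @[t --> +oo] --> 0.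
Proof.
move=> f0; rewrite [X in _ --> X](_ : 0 = 0 * 0); last by rewrite mulr0.
exact: cvgM.
Qed.

Lemma cvg0_mull_bounded (b f : R -> R) (B : R) : (forall t, 0 < t -> `|b t| <= B) ->
  f t @[t --> +oo] --> 0 -> b t * f t @[t --> +oo] --> 0.
Proof.
move=> bB /cvgr0Pnorm_le f0; apply/cvgr0Pnorm_le => e e0.
have B0 : 0 <= B := le_trans (normr_ge0 _) (bB 1 ltr01).
near=> t.
have t0 : 0 < t by near: t; apply: nbhs_pinfty_gt; rewrite num_real.
(* Dividing by [B + 1] covers the case [B = 0]. *)
rewrite normrM; apply: (@le_trans _ _ (B * (e / (B + 1)))).
  apply: ler_pM => //; first exact: bB.
  by near: t; apply: f0; rewrite divr_gt0// ltr_wpDl.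
by rewrite mulrCA -[leRHS]mulr1 ler_pM2l// ler_pdivrMr ?ltr_wpDl// mul1r lerDl.
Unshelve. all: by end_near. Qed.

Lemma cvg0_near_eq f g : (forall t, 0 < t -> f t = g t) ->
  f t @[t --> +oo] --> 0 -> g t @[t --> +oo] --> 0.
Proof.
move=> fg; apply: cvg_trans; apply: near_eq_cvg; near=> t.
by apply: fg; near: t; apply: nbhs_pinfty_gt; rewrite num_real.
Unshelve. all: by end_near. Qed.

Lemma cvg0_sqr_le1 f : f t @[t --> +oo] --> 0 -> \forall t \near +oo, f t ^+ 2 <= 1.
Proof.
move/cvgr0Pnorm_le => /(_ _ ltr01); apply: filterS => t ft.
by rewrite -real_normK ?num_real// expr_le1.
Qed.

Lemma mulr_pinfty (c : R) f : 0 < c -> f t @[t --> +oo] --> +oo ->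
  c * f t @[t --> +oo] --> +oo.
Proof.
move=> c0 /cvgryPge foo; apply/cvgryPge => A.
by apply: filterS (foo (A / c)) => t; rewrite ler_pdivrMr// mulrC.
Qed.

End limits.

(** * The energy of the deviation from the damped rotation *)

Section energy.
Context {R : realType} (w : R) (p f x dx : R -> R).
Notation mu := (@lebesgue_measure R).
Context (w0 : 0 < w)
  (dp : forall t : R, 0 <= t -> derivable p t 1)
  (p0 : forall t : R, 0 <= t -> 0 < p t)
  (dp0 : forall t : R, 0 <= t -> derive1 p t < 0)
  (poo : (\int[mu]_(s in `[0%R, +oo[%classic) (p s)%:E = +oo)%E)
  (p2oo : (\int[mu]_(s in `[0%R, +oo[%classic) (p s ^+ 2)%:E < +oo)%E)
  (lf : locally_integrable0 f) (ldx : locally_integrable0 dx)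
  (lode : locally_integrable0 (fun s => f s - p s * dx s - w ^+ 2 * x s))
  (xE : forall t : R, 0 <= t -> x t = primitive dx t)
  (dxE : forall t : R, 0 <= t -> dx t = primitive (fun s => f s - p s * dx s - w ^+ 2 * x s) t).

Let Y := relax w f.
Let cR := cos_response p Y w.
Let sR := sin_response p Y w.

Let p_derive (t : R) : 0 <= t -> is_derive t 1 p (derive1 p t).
Proof. by move=> t0; apply: DeriveDef; [exact: dp|rewrite derive1E]. Qed.

Let p_continuous (t : R) : 0 <= t -> {for t, continuous p}.
Proof. by move=> t0; exact: is_derive1_continuous (p_derive _ t0). Qed.

Let p_within (T : R) : 0 <= T -> {within `[0, T], continuous p}.
Proof.
move=> T0; apply: continuous_in_subspaceT => t; rewrite inE/= in_itv/= => /andP[t0 _].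
exact: p_continuous.
Qed.

Let lp : locally_integrable0 p.
Proof. by apply: continuous_locally_integrable0; exact: p_within. Qed.

Let lp2 : locally_integrable0 (fun s => p s ^+ 2).
Proof.
apply: continuous_locally_integrable0 => T T0.
by apply: within_continuousM; exact: p_within.
Qed.

Let p_le (t : R) : 0 <= t -> p t <= p 0.
Proof.
move=> t0; apply: (@nincreasing_of_derive _ p (derive1 p) 0) => //.
by move=> s s0; apply/ltW/dp0/ltW.
Qed.

(** Near [t > 0], [dx] agrees with a primitive. Its continuity turns the integrated relation between
    [x] and [dx] into a genuine derivative. *)
Let dx_continuous (t : R) : 0 < t -> {for t, continuous dx}.
Proof.
move=> t0; have := primitive_continuous _ _ lode t0.
rewrite /prop_for /continuous_at -dxE ?(ltW t0)//; apply: cvg_trans.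
apply: near_eq_cvg; near=> s; rewrite -dxE//.
by apply/ltW; near: s; exact: lt_nbhsr.
Unshelve. all: by end_near. Qed.

Let x_derive (t : R) : 0 < t -> is_derive t 1 x (dx t).
Proof.
move=> t0; have := is_derive_primitive _ _ ldx t0 (dx_continuous _ t0).
apply: near_eq_is_derive; near=> s; rewrite -xE//.
by apply/ltW; near: s; exact: lt_nbhsr.
Unshelve. all: by end_near. Qed.

Let v (t : R) := dx t - Y t.

(** Writing [v] as [(primitive f - Y)] minus the primitive of [h] confines [f] to a difference
    already known to be differentiable, while [h] is continuous. *)
Let v_derive (t : R) : 0 < t ->
  is_derive t 1 v (w ^+ 2 * Y t - (p t * dx t + w ^+ 2 * x t)).
Proof.
move=> t0; pose h s := p s * dx s + w ^+ 2 * x s.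
have hE : h = fun s => f s - (f s - p s * dx s - w ^+ 2 * x s).
  by apply/funext => s; rewrite /h; ring.
have lh : locally_integrable0 h.
  move=> T T0; have m0T : measurable (`[0, T] : set R) by [].
  rewrite hE.
  by have := @integrableB _ _ _ mu _ m0T _ _ (lf T T0) (lode T T0); apply: eq_integrable.
have ch : {for t, continuous h}.
  have cx : {for t, continuous x} by exact: is_derive1_continuous (x_derive _ t0).
  apply: cvgD; apply: cvgM => //; first exact/p_continuous/ltW.
    exact: dx_continuous.
  exact: cvg_cst.
have := is_derive1_funB _ _ _ _ _ (is_derive_primitive_sub_relax w f lf t t0)
  (is_derive_primitive _ _ lh t0 ch).
apply: near_eq_is_derive; near=> s.
have s0 : 0 <= s by apply/ltW; near: s; exact: lt_nbhsr.
have m0s : measurable (`[0, s] : set R) by [].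
rewrite /v dxE// -/Y addrAC; congr (_ - _).
rewrite /primitive -RintegralB//; [|exact: lf|exact: lh].
by apply: eq_Rintegral => r _; rewrite ?/h; ring.
Unshelve. all: by end_near. Qed.

Let u (t : R) := v t + 2^-1 * (p t * x t).
(* [u] is chosen so that the coefficients [p'] and [p^2] of the perturbation of
   the damped rotation satisfied by [(D1, D2)] are integrable on [[0, oo)]. *)
Let D1 (t : R) := x t - (cR t + w * sR t).
Let D2 (t : R) := u t - (w ^+ 2 * cR t - w * sR t).
Let V (t : R) := w ^+ 2 * D1 t ^+ 2 + D2 t ^+ 2.
Let dV (t : R) := - (p t * V t) + (derive1 p t + 2^-1 * p t ^+ 2) * x t * D2 t
   - p t * Y t * D2 t.

(** The rotation contributes [2 w^2 D1 D2] with opposite signs to the two squares; what survives is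
    the damping and the forcing of [D2]. *)
Let V_derive (t : R) : 0 < t -> is_derive t 1 V (dV t).
Proof.
move=> t0.
have [dc ds] := is_derive_responses p Y w lp (relax_within w f lf) t t0
  (p_continuous _ (ltW t0)) (relax_continuous w f lf t t0).
rewrite -/cR -/sR in dc ds.
have dxt := x_derive _ t0.
have dpt := p_derive _ (ltW t0).
have du := is_derive1_funD _ _ _ _ _ (v_derive _ t0)
  (is_derive1_funMc _ 2^-1 _ _ (is_derive1_funM _ _ _ _ _ dpt dxt)).
have dD1 := is_derive1_funB _ _ _ _ _ dxt
  (is_derive1_funD _ _ _ _ _ dc (is_derive1_funMc _ w _ _ ds)).
have dD2 := is_derive1_funB _ _ _ _ _ du
  (is_derive1_funB _ _ _ _ _ (is_derive1_funMc _ (w ^+ 2) _ _ dc) (is_derive1_funMc _ w _ _ ds)).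
apply: is_derive_eq (is_derive1_funD _ _ _ _ _
  (is_derive1_funMc _ (w ^+ 2) _ _ (is_derive1_funM _ _ _ _ _ dD1 dD1))
  (is_derive1_funM _ _ _ _ _ dD2 dD2)) _.
by rewrite /dV /V /D1 /D2 /u /v; field.
Qed.

(* [r] dominates [|p' / 2 + p^2 / 4|], and has a bounded primitive because [p]
   is monotone. *)
Let r (t : R) := 2^-1 * - derive1 p t + 4^-1 * p t ^+ 2.

(** The gap between the two sides is a sum of squares with nonnegative weights [p^2], [- p'] and
    [p]. Half of the damping pays for the cross term [p Y D2]. *)
Let V_le (t : R) : 0 < t ->
  dV t <= - (2^-1 * p t * V t) + r t * (D2 t ^+ 2 + x t ^+ 2) + 2^-1 * p t * Y t ^+ 2.
Proof.
move=> t0.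
have pt := ltW (p0 _ (ltW t0)).
have i1 : 0 <= p t ^+ 2 * (D2 t - x t) ^+ 2 by rewrite mulr_ge0 ?sqr_ge0.
have i2 : 0 <= - derive1 p t * (D2 t + x t) ^+ 2.
  by rewrite mulr_ge0 ?sqr_ge0// oppr_ge0 ltW// dp0// ltW.
have i3 : 0 <= p t * (Y t + D2 t) ^+ 2 by rewrite mulr_ge0 ?sqr_ge0.
have i4 : 0 <= p t * (w ^+ 2 * D1 t ^+ 2).
  by rewrite mulr_ge0// mulr_ge0 ?sqr_ge0.
rewrite /dV /V /r.
set d := derive1 p t in i2 *.
move: (D1 t) (D2 t) (x t) (Y t) (p t) i1 i2 i3 i4 => a b c e q i1 i2 i3 i4.
rewrite -subr_ge0.
have -> : - (2^-1 * q * (w ^+ 2 * a ^+ 2 + b ^+ 2)) +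
    (2^-1 * - d + 4^-1 * q ^+ 2) * (b ^+ 2 + c ^+ 2) + 2^-1 * q * e ^+ 2 -
    (- (q * (w ^+ 2 * a ^+ 2 + b ^+ 2)) + (d + 2^-1 * q ^+ 2) * c * b - q * e * b) =
  4^-1 * (q ^+ 2 * (b - c) ^+ 2) + 2^-1 * (- d * (b + c) ^+ 2) +
  2^-1 * (q * (e + b) ^+ 2) + 2^-1 * (q * (w ^+ 2 * a ^+ 2)).
  by field.
by rewrite !addr_ge0// mulr_ge0// invr_ge0.
Qed.

(** [C] and [h] stay free because the two implications control [x] differently: through [D1] and the
    first integral of (A), or directly. *)
Let V_cvg0 (C : R) (h : R -> R) : 0 <= C ->
  (forall t : R, 0 < t -> D2 t ^+ 2 + x t ^+ 2 <= C * V t + h t) ->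
  (\forall t \near +oo, h t <= 2) ->
  Y t @[t --> +oo] --> 0 -> V t @[t --> +oo] --> 0.
Proof.
move=> C0 hC h2 Y0.
have [B pB] := primitive_bounded _ lp2 (fun s _ => sqr_ge0 (p s)) p2oo.
(* An explicit primitive of [r]: the first summand is at most [p 0 / 2] by positivity of [p], the
   second at most [B / 4]. *)
pose Q t := 2^-1 * (p 0 - p t) + 4^-1 * primitive (fun s => p s ^+ 2) t.
have r0 (t : R) : 0 < t -> 0 <= r t.
  move=> t0; rewrite addr_ge0// mulr_ge0 ?sqr_ge0 ?invr_ge0//.
  by rewrite oppr_ge0 ltW// dp0// ltW.
have Voo (t : R) : 0 < t -> 0 <= V t.
  by move=> t0; rewrite addr_ge0 ?sqr_ge0// mulr_ge0 ?sqr_ge0.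
have := @cvg0_of_differential_inequality R (fun t => 2^-1 * p t)
  (fun t => 2^-1 * primitive p t) r Q (fun t => Y t ^+ 2) h V dV C 2 (p 0 + B); apply.
- move=> t t0; apply: is_derive1_funMc; apply: is_derive_primitive => //.
  exact/p_continuous/ltW.
- move=> t t0.
  have d2 : is_derive t 1 (primitive (fun s => p s ^+ 2)) (p t ^+ 2).
    apply: (is_derive_primitive _ _ lp2 t0).
    by apply: cvgM; exact/p_continuous/ltW.
  apply: is_derive_eq (is_derive1_funD _ _ _ _ _ (is_derive1_funMc _ 2^-1 _ _
    (is_derive1_funB _ _ _ _ _ (is_derive_cst (p 0) t 1) (p_derive _ (ltW t0))))
    (is_derive1_funMc _ 4^-1 _ _ d2)) _.
  by rewrite /r sub0r.
- exact: V_derive.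
- by move=> t t0; rewrite mulr_ge0// ltW// p0// ltW.
- exact: r0.
- exact: Voo.
- move=> t t0; have := p_le _ (ltW t0); have := p0 _ (ltW t0).
  have := pB _ (ltW t0); rewrite /Q => /andP[]; lra.
- apply: mulr_pinfty => //; apply: primitive_infty => // s s0.
  exact/ltW/p0.
- exact: cvg0_sqr.
- exact: h2.
- exact: C0.
- by [].
- move=> t t0; apply: le_trans (V_le _ t0) _.
  by rewrite lerD2r lerD2l ler_wpM2l// ?r0// hC.
Qed.

Let D_cvg0 : V t @[t --> +oo] --> 0 ->
  (D1 t @[t --> +oo] --> 0) /\ (D2 t @[t --> +oo] --> 0).
Proof.
move=> V0; split.
- apply: (@cvg0_of_sqr_le _ D1 V (w ^+ 2)) => //; first exact: exprn_gt0.
  by near=> t; rewrite lerDl sqr_ge0.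
- apply: (@cvg0_of_sqr_le _ D2 V 1) => //.
  by near=> t; rewrite mul1r lerDr mulr_ge0 ?sqr_ge0.
Unshelve. all: by end_near. Qed.

(** Under (B), [v' = w^2 (z - v)] with [z] tending to 0, so the differential inequality with
    constant damping [w^2] applies to [v^2]; then [Y = x' - v]. *)
Let Y_cvg0 : x t @[t --> +oo] --> 0 -> dx t @[t --> +oo] --> 0 ->
  Y t @[t --> +oo] --> 0.
Proof.
move=> x0 dx0.
pose g t := w ^+ 2 * dx t - p t * dx t - w ^+ 2 * x t.
have g0 : g t @[t --> +oo] --> 0.
  have px : p t * dx t @[t --> +oo] --> 0.
    apply: (@cvg0_mull_bounded _ _ _ (p 0)) dx0 => t t0.
    by rewrite ger0_norm ?p_le// ltW// ?p0// ltW.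
  have -> : (0 : R) = w ^+ 2 * 0 - 0 - w ^+ 2 * 0 by rewrite !mulr0 !subr0.
  by apply: cvgB; [apply: cvgB => //|]; apply: cvgM => //; exact: cvg_cst.
pose z t := (w ^+ 2)^-1 * g t.
have w2 : 0 < w ^+ 2 by exact: exprn_gt0.
have z0 : z t @[t --> +oo] --> 0.
  have -> : (0 : R) = (w ^+ 2)^-1 * 0 by rewrite mulr0.
  by apply: cvgM => //; exact: cvg_cst.
have v0 : v t ^+ 2 @[t --> +oo] --> 0.
  pose v' t := w ^+ 2 * Y t - (p t * dx t + w ^+ 2 * x t).
  have := @cvg0_of_differential_inequality R (fun=> w ^+ 2) (fun t => w ^+ 2 * t)
    (fun=> 0) (fun=> 0) (fun t => z t ^+ 2) (fun=> 0) (fun t => v t ^+ 2)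
    (fun t => v t * v' t + v t * v' t) 0 0 0; apply.
  - by move=> t _; apply: is_derive_eq (is_derive1_funMc id (w ^+ 2) t 1 _) _; rewrite ?mulr1.
  - by move=> t t0; apply: is_derive1_funM; exact: v_derive.
  - by move=> t _; rewrite sqr_ge0.
  - by [].
  - by move=> t _; rewrite sqr_ge0.
  - by move=> t _; rewrite !lexx.
  - by apply: mulr_pinfty => //; exact: cvg_id.
  - exact: cvg0_sqr.
  - by near=> t.
  - by [].
  - by [].
  - move=> t t0; have -> : v' t = w ^+ 2 * (z t - v t).
      rewrite /v' /z /g /v; field.
      by rewrite gt_eqF.
    (* This is [2 v z <= v^2 + z^2], which bounds [2 v v'] by [w^2 (z^2 - v^2)]. *)
    have : 0 <= w ^+ 2 * (z t - v t) ^+ 2 by rewrite mulr_ge0 ?sqr_ge0.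
    nra.
have vv : v t @[t --> +oo] --> 0.
  apply: (@cvg0_of_sqr_le _ v _ 1) v0 => //.
  by near=> t; rewrite mul1r.
have -> : Y = fun t => dx t - v t by apply/funext => t; rewrite /v; ring.
have -> : (0 : R) = 0 - 0 by rewrite subr0.
exact: cvgB.
Unshelve. all: by end_near. Qed.

Lemma responses_cvg0_iff :
  ((Y t @[t --> +oo] --> 0) /\ (cR t + w * sR t @[t --> +oo] --> 0) /\
    (w ^+ 2 * cR t - w * sR t @[t --> +oo] --> 0)) <->
  ((x t @[t --> +oo] --> 0) /\ (dx t @[t --> +oo] --> 0)).
Proof.
have w2 : 0 < w ^+ 2 by exact: exprn_gt0.
have zero2 : (0 : R) = 0 + 0 by rewrite addr0.
have px0 : x t @[t --> +oo] --> 0 -> 2^-1 * (p t * x t) @[t --> +oo] --> 0.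
  move=> x0; have -> : (0 : R) = 2^-1 * 0 by rewrite mulr0.
  apply: cvgM; first exact: cvg_cst.
  apply: (@cvg0_mull_bounded _ _ _ (p 0)) x0 => t t0.
  by rewrite ger0_norm ?p_le// ltW// ?p0// ltW.
split=> [[Y0 [I10 I20]]|[x0 dx0]].
- have V0 : V t @[t --> +oo] --> 0.
    (* From [x = D1 + I1], [x^2 <= 2 D1^2 + 2 I1^2]; with [D1^2 <= V / w^2] and [D2^2 <= V] this
       gives [C = 1 + 2 / w^2]. *)
    apply: (@V_cvg0 (1 + 2 * (w ^+ 2)^-1) (fun t => 2 * (cR t + w * sR t) ^+ 2)) => //.
    + by rewrite addr_ge0// mulr_ge0// invr_ge0 ltW.
    + move=> t t0.
      have -> : x t = D1 t + (cR t + w * sR t) by rewrite /D1; ring.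
      have -> : (1 + 2 * (w ^+ 2)^-1) * V t =
          V t + 2 * (D1 t ^+ 2 + (w ^+ 2)^-1 * D2 t ^+ 2).
        by rewrite /V; field; rewrite gt_eqF.
      rewrite /V.
      have : 0 <= w ^+ 2 * D1 t ^+ 2 by rewrite mulr_ge0 ?sqr_ge0.
      have : 0 <= (w ^+ 2)^-1 * D2 t ^+ 2 by rewrite mulr_ge0 ?invr_ge0 ?sqr_ge0.
      have := sqr_ge0 (D1 t - (cR t + w * sR t)).
      move: (D1 t) (D2 t) (cR t + w * sR t) => a b c; nra.
    + apply: filterS (cvg0_sqr_le1 _ I10) => t.
      lra.
  have [D10 D20] := D_cvg0 V0.
  have x0 : x t @[t --> +oo] --> 0.
    rewrite zero2 (_ : x = fun t => D1 t + (cR t + w * sR t)); first exact: cvgD.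
    by apply/funext => t; rewrite /D1; ring.
  split => //.
  (* The definitions of [u], [v] and [D2] are solved for [x']. *)
  rewrite (_ : dx = fun t => D2 t + (w ^+ 2 * cR t - w * sR t) + Y t - 2^-1 * (p t * x t)).
    have -> : (0 : R) = 0 + 0 + 0 - 0 by rewrite !addr0 subr0.
    by apply: cvgB; [apply: cvgD => //; exact: cvgD|exact: px0].
  by apply/funext => t; rewrite /D2 /u /v; ring.
- have Y0 := Y_cvg0 x0 dx0.
  have V0 : V t @[t --> +oo] --> 0.
    (* Here [x] is itself small, so [D2^2 <= V] suffices and [h = x^2]. *)
    apply: (@V_cvg0 1 (fun t => x t ^+ 2)) => //.
    + by move=> t t0; rewrite mul1r lerD2r /V lerDr mulr_ge0 ?sqr_ge0.
    + apply: filterS (cvg0_sqr_le1 _ x0) => t.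
      lra.
  have [D10 D20] := D_cvg0 V0.
  split => //; split.
    rewrite (_ : (fun t => _) = fun t => x t - D1 t).
      by have -> : (0 : R) = 0 - 0; [rewrite subr0|exact: cvgB].
    by apply/funext => t; rewrite /D1; ring.
  rewrite (_ : (fun t => _) = fun t => dx t - Y t + 2^-1 * (p t * x t) - D2 t).
    have -> : (0 : R) = 0 - 0 + 0 - 0 by rewrite !subr0 addr0.
    apply: cvgB => //; apply: cvgD; [exact: cvgB|exact: px0].
  by apply/funext => t; rewrite /D2 /u /v; ring.
Qed.

End energy.

Theorem mainTheorem10 (R : realType) (w : R) (p f x dx : R -> R) :
  0 < w ->
  (* p in C^1([0,oo)), p > 0, p' < 0 *)
  (forall t : R, 0 <= t -> derivable p t 1) ->
  (forall t : R, 0 <= t -> derive1 p s @[s --> t] --> derive1 p t) ->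
  (forall t : R, 0 <= t -> 0 < p t) ->
  (forall t : R, 0 <= t -> derive1 p t < 0) ->
  (\int[@lebesgue_measure R]_(s in `[0%R, +oo[%classic) (p s)%:E = +oo)%E ->
  (\int[@lebesgue_measure R]_(s in `[0%R, +oo[%classic) (p s ^+ 2)%:E < +oo)%E ->
  (* f in L^1_loc([0,oo)) *)
  (forall T : R, 0 <= T -> (@lebesgue_measure R).-integrable `[0, T] (EFin \o f)) ->
  (* x is the (Caratheodory) solution of x'' + p x' + w^2 x = f, x(0) = x'(0) = 0,
     with x' = dx, in integrated form *)
  (forall T : R, 0 <= T -> (@lebesgue_measure R).-integrable `[0, T] (EFin \o dx)) ->
  (forall T : R, 0 <= T -> (@lebesgue_measure R).-integrable `[0, T]
      (fun s => (f s - p s * dx s - w ^+ 2 * x s)%:E)) ->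
  (forall t : R, 0 <= t -> x t = Rintegral (@lebesgue_measure R) `[0, t] dx) ->
  (forall t : R, 0 <= t -> dx t = Rintegral (@lebesgue_measure R) `[0, t]
      (fun s => f s - p s * dx s - w ^+ 2 * x s)) ->
  ((y1 w f t @[t --> +oo%R] --> 0) /\
   (Rintegral (@lebesgue_measure R) `[0, t]
      (fun s => Ef p t s * L1 w t s * y1 w f s) @[t --> +oo%R] --> 0) /\
   (Rintegral (@lebesgue_measure R) `[0, t]
      (fun s => Ef p t s * L2 w t s * y1 w f s) @[t --> +oo%R] --> 0))
  <->
  ((x t @[t --> +oo%R] --> 0) /\ (dx t @[t --> +oo%R] --> 0)).
Proof.
move=> w0 dp _ p0 dp0 poo p2oo lf ldx lode xE dxE.
have := @responses_cvg0_iff R w p f x dx w0 dp p0 dp0 poo p2oo lf ldx lode xE dxE.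
set Y := relax w f; set cR := cos_response p Y w; set sR := sin_response p Y w => iffR.
have lp : locally_integrable0 p.
  apply: continuous_locally_integrable0 => T T0; apply: continuous_in_subspaceT => t.
  rewrite inE/= in_itv/= => /andP[t0 _].
  by apply/differentiable_continuous/derivable1_diffP/dp.
have cY := relax_within w f lf.
(* Both kernels have the form [al cos + be sin]: [(1, w)] gives [L1] and [(w^2, - w)] gives [L2]. *)
have IE (al be : R) (L : R -> R -> R -> R) (t : R) : (forall s, L w t s =
    al * cos (w * (t - s)) + be * sin (w * (t - s))) -> 0 <= t ->
    Rintegral (@lebesgue_measure R) `[0, t] (fun s => Ef p t s * L w t s * y1 w f s) =
    al * cR t + be * sR t.
  move=> LE t0; rewrite -damped_integralE//.
  apply: eq_Rintegral => s; rewrite inE/= in_itv/= => /andP[s0 _].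
  by rewrite LE y1E.
have I1E t : 0 < t -> Rintegral (@lebesgue_measure R) `[0, t]
    (fun s => Ef p t s * L1 w t s * y1 w f s) = cR t + w * sR t.
  by move=> t0; rewrite (IE 1 w) ?mul1r ?(ltW t0)// => s; rewrite /L1; ring.
have I2E t : 0 < t -> Rintegral (@lebesgue_measure R) `[0, t]
    (fun s => Ef p t s * L2 w t s * y1 w f s) = w ^+ 2 * cR t - w * sR t.
  by move=> t0; rewrite (IE (w ^+ 2) (- w)) ?mulNr ?(ltW t0)// => s; rewrite /L2; ring.
have YE t : 0 < t -> y1 w f t = Y t by move=> t0; rewrite y1E// ltW.
split=> [[h0 [h1 h2]]|/iffR[h0 [h1 h2]]].
  apply/iffR; split; first exact: cvg0_near_eq YE h0.
  by split; [exact: cvg0_near_eq I1E h1|exact: cvg0_near_eq I2E h2].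
split; first by apply: cvg0_near_eq h0 => t /YE.
by split; [apply: cvg0_near_eq h1 => t /I1E|apply: cvg0_near_eq h2 => t /I2E].
Qed.
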